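(* Let $n\ge 3$ be an integer. Then $\alpha_=(Q_n)\ge 2^{n-2}$.
   Context: $Q_n$ is the hypercube on $\{0,1\}^n$, vertices adjacent iff they differ in exactly one coordinate; it is bipartite with classes the vertices of even and of odd Hamming weight. For a bipartite graph $G$ with bipartition classes $V_0,V_1$, the equi-independence number $\alpha_=(G)$ is the maximum cardinality of an independent set $I$ of $G$ with $|I\cap V_0|=|I\cap V_1|$. *)

(* Defs.v *)
From mathcomp Require Import all_boot.
Set Implicit Arguments.
Unset Strict Implicit.
Unset Printing Implicit Defensive.

(* A finite simple graph on T is given by its adjacency relation e. *)

Definition independent (T : finType) (e : rel T) (I : {set T}) : bool :=
  [forall x in I, forall y in I, ~~ e x y].

Definition bipartition (T : finType) (e : rel T) (V0 V1 : {set T}) : Prop :=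
  [/\ V0 :|: V1 = [set: T], [disjoint V0 & V1]
    & forall x y, e x y -> (x \in V0) != (y \in V0)].

(* The index set of the maximum contains set0, so it is never empty. *)
Definition equi_independence (T : finType) (e : rel T) (V0 V1 : {set T}) : nat :=
  \max_(I : {set T} | independent e I && (#|I :&: V0| == #|I :&: V1|)) #|I|.

Definition cube (n : nat) : finType := {ffun 'I_n -> bool}.

Definition cube_adj (n : nat) : rel (cube n) :=
  fun x y => #|[set i | x i != y i]| == 1.

Definition hamming_weight (n : nat) (x : cube n) : nat := #|[set i | x i]|.

Definition cube_even (n : nat) : {set cube n} :=
  [set x | ~~ odd (hamming_weight x)].

Definition cube_odd (n : nat) : {set cube n} :=
  [set x | odd (hamming_weight x)].

Lemma cube_adj_sym (n : nat) : symmetric (@cube_adj n).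
Proof.
move=> x y; rewrite /cube_adj; congr (_ == 1).
by apply: eq_card => i; rewrite !inE eq_sym.
Qed.

Lemma cube_adj_irr (n : nat) : irreflexive (@cube_adj n).
Proof.
move=> x; rewrite /cube_adj eq_card0 // => i.
by rewrite !inE eqxx.
Qed.

Lemma cube_bipartition (n : nat) :
  bipartition (@cube_adj n) (cube_even n) (cube_odd n).
Proof.
split.
- by apply/setP=> x; rewrite !inE orNb.
- by apply/pred0P=> x; rewrite /= !inE andNb.
move=> x y; rewrite /cube_adj => /cards1P[i Exy]; rewrite !inE.
have Di j : (x j != y j) = (j == i) by have:= in_set1 j i; rewrite -Exy inE.
have wE (z : cube n) : hamming_weight z = z i + \sum_(j | j != i) z j.
  rewrite /hamming_weight -sum1_card big_mkcond (bigD1 i) //= inE.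
  by congr (_ + _); apply: eq_bigr => j _; rewrite inE.
rewrite (wE x) (wE y) (eq_bigr (fun j => nat_of_bool (y j))); last first.
  move=> j /negPf ji; have := Di j; rewrite ji => /negbFE/eqP-> //.
have := Di i; rewrite eqxx !oddD.
by case: (x i); case: (y i); case: (odd (\sum_(_ | _) _)).
Qed.

(* Main.v *)
(* Write n = m + 2 and prepend to each y in {0,1}^m its own parity twice.  The
   extended word keeps the parity of y, so the 2^m extended words are balanced
   because Q_m is (m >= 1).  Adjacent words have different parities, whereas
   extended words of different parities already differ in the two prepended
   coordinates, so they form an independent set. *)
Require Import Defs.
From mathcomp Require Import all_boot.

Definition flip {n : nat} (i : 'I_n) (x : cube n) : cube n :=
  [ffun j => if j == i then ~~ x j else x j].

Lemma flipK {n : nat} (i : 'I_n) : involutive (flip i).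
Proof.
by move=> x; apply/ffunP=> j; rewrite !ffunE; case: (j == i); rewrite ?negbK.
Qed.

Lemma cube_adj_flip {n : nat} (i : 'I_n) (x : cube n) : cube_adj x (flip i x).
Proof.
apply/cards1P; exists i; apply/setP=> j; rewrite !inE ffunE.
by case: (j == i); [case: (x j) | rewrite eqxx].
Qed.

Lemma cube_adj_odd {n : nat} {x y : cube n} :
  cube_adj x y -> odd (hamming_weight y) = ~~ odd (hamming_weight x).
Proof.
have [_ _ bip] := cube_bipartition n; move=> /bip; rewrite !inE.
by do 2!case: (odd _).
Qed.

(** Flipping one coordinate is an involution that swaps the two classes; [0 < n] supplies coordinate
    0 to flip. *)
Lemma card_cube_even_odd (n : nat) :
  0 < n -> #|cube_even n| = #|cube_odd n|.
Proof.
case: n => // n _; rewrite -(card_imset _ (inv_inj (flipK ord0))).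
apply: eq_card => x; rewrite -[x in LHS](flipK ord0).
rewrite (mem_imset _ _ (inv_inj (flipK ord0))) !inE.
by rewrite (cube_adj_odd (cube_adj_flip ord0 x)) negbK.
Qed.

(** In this form the two prepended coordinates can be split off with [big_ord_recl]. *)
Lemma hamming_weightE (n : nat) (x : cube n) : hamming_weight x = \sum_i x i.
Proof.
rewrite /hamming_weight -sum1_card big_mkcond.
by apply: eq_bigr => i _; rewrite inE; case: (x i).
Qed.

Definition parity_extend {m : nat} (y : cube m) : cube m.+2 :=
  [ffun i => if unlift ord0 i is Some j then
               if unlift ord0 j is Some k then y k else odd (hamming_weight y)
             else odd (hamming_weight y)].

Section ParityExtend.

Context {m : nat}.
Implicit Types y z : cube m.

Lemma parity_extend0 y : parity_extend y ord0 = odd (hamming_weight y).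
Proof. by rewrite ffunE unlift_none. Qed.

Lemma parity_extend1 y :
  parity_extend y (lift ord0 ord0) = odd (hamming_weight y).
Proof. by rewrite ffunE liftK unlift_none. Qed.

Lemma parity_extend_lift y k :
  parity_extend y (lift ord0 (lift ord0 k)) = y k.
Proof. by rewrite ffunE !liftK. Qed.

Lemma parity_extend_inj : injective (@parity_extend m).
Proof.
by move=> y z eq_yz; apply/ffunP=> k; rewrite -!parity_extend_lift eq_yz.
Qed.

(** The two prepended bits are equal, so they cancel modulo 2. *)
Lemma odd_parity_extend y :
  odd (hamming_weight (parity_extend y)) = odd (hamming_weight y).
Proof.
rewrite hamming_weightE !big_ord_recl parity_extend0 parity_extend1.
under eq_bigr do rewrite parity_extend_lift.
by rewrite -hamming_weightE !oddD addbA addbb.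
Qed.

Lemma parity_extend_nadj y z :
  ~~ cube_adj (parity_extend y) (parity_extend z).
Proof.
apply/negP=> adj; have := cube_adj_odd adj; rewrite !odd_parity_extend => oddz.
have /cards1P[i Ei] := adj.
(* By [oddz] the prepended bits of the two words are opposite, so coordinates 0 and 1 both lie in
   the singleton of differing positions, which is absurd. *)
have i0 : ord0 \in [set i].
  by rewrite -Ei inE !parity_extend0 oddz; case: (odd _).
have: lift ord0 ord0 \in [set i].
  by rewrite -Ei inE !parity_extend1 oddz; case: (odd _).
by rewrite inE -(set1P i0).
Qed.

(** Together with the odd case and injectivity, this reduces the balance of the image to that of
    $Q_m$. *)
Lemma parity_extend_even :
  parity_extend @: setT :&: cube_even m.+2 = parity_extend @: cube_even m.
Proof.
apply/setP=> x; rewrite inE; apply/andP/imsetP=> [[/imsetP[y _ ->]]|[y yE ->]].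
  by rewrite inE odd_parity_extend => yE; exists y; rewrite ?inE.
by rewrite imset_f ?inE // odd_parity_extend; move: yE; rewrite inE.
Qed.

Lemma parity_extend_odd :
  parity_extend @: setT :&: cube_odd m.+2 = parity_extend @: cube_odd m.
Proof.
apply/setP=> x; rewrite inE; apply/andP/imsetP=> [[/imsetP[y _ ->]]|[y yO ->]].
  by rewrite inE odd_parity_extend => yO; exists y; rewrite ?inE.
by rewrite imset_f ?inE // odd_parity_extend; move: yO; rewrite inE.
Qed.

End ParityExtend.

Theorem theorem4 (n : nat) (hn : 3 <= n) :
  2 ^ (n - 2) <= equi_independence (@cube_adj n) (cube_even n) (cube_odd n).
Proof.
(* Here [m] is $n-2$, and [hn] reduces to $0 < m$, which the balance of $Q_m$ uses at the end. *)
case: n hn => [|[|m]] // m_gt0; rewrite subn2 /=.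
have cardI : #|@parity_extend m @: setT| = 2 ^ m.
  by rewrite (card_imset _ parity_extend_inj) cardsT card_ffun card_bool card_ord.
rewrite -cardI; apply: leq_bigmax_cond; apply/andP; split.
  apply/forall_inP=> _ /imsetP[y _ ->]; apply/forall_inP=> _ /imsetP[z _ ->].
  exact: parity_extend_nadj.
rewrite parity_extend_even parity_extend_odd !(card_imset _ parity_extend_inj).
by rewrite card_cube_even_odd.
Qed.
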